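(* For every $d\ge 2$, the magneto-spectral height of the $d$-regular complete bipartite graph $K_{d,d}$ satisfies $$\nu(K_{d,d})=d-\sqrt d.$$
   Context: All graphs $G=(V,E)$ are finite and simple; $x\sim y$ denotes adjacency. $E^{or}(G)$ is the set of ordered pairs $(x,y)$ with $x\sim y$. A magnetic potential is a map $\sigma:E^{or}(G)\to S^1=\{z\in\mathbb{C}:|z|=1\}$ with $\sigma(y,x)=\sigma(x,y)^{-1}$. The magnetic Laplacian on functions $f:V\to\mathbb{C}$ is $\Delta^\sigma f(x)=\sum_{y\sim x}(f(x)-\sigma(x,y)f(y))$, and $\lambda_1^\sigma(G)$ is its smallest eigenvalue. The magneto-spectral height is $\nu(G)=\sup_\sigma\lambda_1^\sigma(G)$, over all magnetic potentials. *)

(* Defs.v *)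
From HB Require Import structures.
From mathcomp Require Import all_boot all_order all_algebra.
From mathcomp Require Import complex.
From mathcomp Require Import boolp classical_sets reals.

Set Implicit Arguments.
Unset Strict Implicit.
Unset Printing Implicit Defensive.

Import Order.TTheory GRing.Theory Num.Theory.

Local Open Scope ring_scope.
Local Open Scope complex_scope.
Local Open Scope classical_set_scope.

Record sgraph := SGraph {
  vertex :> finType;
  adj : rel vertex;
  adj_sym : symmetric adj;
  adj_irr : irreflexive adj }.

Section CompleteBipartite.
Variables m n : nat.

Definition cbip_adj : rel ('I_m + 'I_n) :=
  fun x y => match x, y with
             | inl _, inr _ | inr _, inl _ => true
             | _, _ => false
             end.

Lemma cbip_sym : symmetric cbip_adj.
Proof. by case=> x [] y. Qed.

Lemma cbip_irr : irreflexive cbip_adj.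
Proof. by case. Qed.

Definition complete_bipartite : sgraph := SGraph cbip_sym cbip_irr.

End CompleteBipartite.

Section MagneticLaplacian.
Variables (R : realType) (G : sgraph).

(* A potential is defined on ordered pairs of adjacent vertices.  It is encoded
   as a total function whose values at non-adjacent pairs are unconstrained;
   the Laplacian below does not read them. *)
Definition magnetic_potential (sigma : G -> G -> R[i]) : Prop :=
  forall x y : G, adj x y ->
    `|sigma x y| = 1 /\ sigma y x = (sigma x y)^-1.

(* The codomain is R[i]^o so that functions on the vertices form a
   finite-dimensional vector space over R[i]. *)
Definition magnetic_laplacian (sigma : G -> G -> R[i])
    (f : {ffun G -> R[i]^o}) : {ffun G -> R[i]^o} :=
  [ffun x => \sum_(y | adj x y) (f x - sigma x y * f y)].

Lemma magnetic_laplacian_linear sigma : linear (magnetic_laplacian sigma).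
Proof.
move=> a f g; apply/ffunP => x; rewrite !ffunE scaler_sumr -big_split /=.
apply: eq_bigr => y _; rewrite !ffunE /GRing.scale /= mulrDr mulrBr.
by rewrite mulrCA addrACA opprD.
Qed.

HB.instance Definition _ sigma :=
  GRing.isLinear.Build R[i] {ffun G -> R[i]^o} {ffun G -> R[i]^o} *:%R
    (magnetic_laplacian sigma) (magnetic_laplacian_linear sigma).

End MagneticLaplacian.

(* In the order on R[i], l%:C <= mu means that mu is real and at least l. *)
Definition smallest_eigenvalue (R : realType) (vT : vectType R[i])
    (phi : 'End(vT)) (l : R) : Prop :=
  passmx.leigenvalue phi l%:C /\
  forall mu : R[i], passmx.leigenvalue phi mu -> l%:C <= mu.

(* The default value 0 is only used when G has no vertex: the Laplacian of a
   magnetic potential is self-adjoint. *)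
Definition lambda1 (R : realType) (G : sgraph) (sigma : G -> G -> R[i]) : R :=
  xget 0 [set l | smallest_eigenvalue (linfun (magnetic_laplacian sigma)) l].

Definition magneto_spectral_height (R : realType) (G : sgraph) : R :=
  sup [set lambda1 sigma | sigma in @magnetic_potential R G].

(* Main.v *)
Require Import Defs.
From mathcomp Require Import all_boot all_order all_algebra.
From mathcomp Require Import separable cyclotomic complex.
From mathcomp Require Import boolp classical_sets reals.

(** The Laplacian of K_{d,d} is [d] times the identity minus an operator that
exchanges the two sides of the bipartition, acting from right to left by the
[d] x [d] matrix [B] of values of the potential and from left to right by its
conjugate transpose [B^*].  If [v != 0] and [B B^* v = s^2 v] with [s != 0],
then [(v, s^-1 B^* v)] is an eigenfunction for [d - s]; hence the smallest
eigenvalue is controlled by the largest eigenvalue of [B B^*].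

Upper bound: the entries of [B] have modulus one, so [B B^*] is Hermitian with
trace [d^2], and by averaging ([hermitian_eigen_ge_avg]) one of its [d]
eigenvalues is real and at least [d].  Thus every potential has an eigenvalue
at most [d - sqrt d] ([lambda1_le]).

Attainment: averaging loses nothing exactly when [B B^* = d I], that is, when
[B] is a complex Hadamard matrix; the Fourier matrix of the [d]-th roots of
unity is one ([fourier_potential]).  The exchange operator then squares to
[d I], so the only eigenvalues are [d - sqrt d] and [d + sqrt d]
([lambda1_of_orthogonal]). *)

Import Order.TTheory GRing.Theory Num.Theory.
Local Open Scope ring_scope.
Local Open Scope complex_scope.
Local Open Scope sesquilinear_scope.

(** * Eigenvalues, traces and roots of unity *)

(** The trace is the sum of the real eigenvalues, so they cannot all lie below
the average. *)
Lemma hermitian_eigen_ge_avg (C : numClosedFieldType) n (M : 'M[C]_n) :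
  (0 < n)%N -> M \is hermsymmx ->
  exists2 mu : C, exists2 v : 'cV[C]_n, v != 0 & M *m v = mu *: v
                & \tr M <= n%:R * mu.
Proof.
move=> n_gt0 hM.
have [P [D [P_unit D_real defM]]] : exists P (D : 'rV_n),
    [/\ P \in unitmx, forall j, D 0 j \is Num.real
       & M = invmx P *m diag_mx D *m P].
  exists (spectralmx M), (spectral_diag M); split.
  - exact: spectral_unit.
  - by move=> j; apply: (mxOverP (hermitian_spectral_diag_real hM)).
  - exact/orthomx_spectralP/hermitian_normalmx.
have trM : \tr M = \sum_j D 0 j.
  by rewrite defM mxtrace_mulC mulmxA mulmxV // mul1mx mxtrace_diag.
have eigM j : M *m col j (invmx P) = D 0 j *: col j (invmx P).
  have MP : M *m invmx P = invmx P *m diag_mx D by rewrite defM mulmxK.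
  rewrite [in LHS]colE mulmxA MP -colE.
  by apply/matrixP=> i k; rewrite mul_mx_diag !mxE mulrC.
have col_neq0 j : col j (invmx P) != 0.
  apply/eqP=> /(congr1 (mulmx P)); rewrite colE mulmxA mulmxV // mul1mx mulmx0.
  by move=> /matrixP/(_ j 0)/eqP; rewrite !mxE eqxx oner_eq0.
(* In the order of [C] a negated [<=] means [<] only between reals. *)
have [/existsP[j leD]|] := boolP [exists j, \tr M <= n%:R * D 0 j].
  by exists (D 0 j) => //; exists (col j (invmx P)).
rewrite negb_exists => /forallP ltD.
have trM_real : \tr M \is Num.real by rewrite trM rpred_sum.
have lt_sum : \sum_(j < n) n%:R * D 0 j < \sum_(j < n) \tr M.
  apply: ltr_sum => [|j _].
    by apply/hasP; exists (Ordinal n_gt0); rewrite ?mem_index_enum.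
  by rewrite real_ltNge // rpredM ?rpred_nat.
by move: lt_sum; rewrite -mulr_sumr -trM sumr_const card_ord mulr_natl ltxx.
Qed.

(** X^n - 1 splits and is separable in characteristic zero. *)
Lemma distinct_unity_roots (C : numClosedFieldType) n : (0 < n)%N ->
  exists2 r : 'I_n -> C, injective r & forall k, r k ^+ n = 1.
Proof.
move=> n_gt0; pose p : {poly C} := 'X^n - 1.
have [s] := closed_field_poly_normal p.
rewrite (monicP _) ?monicXnsubC // scale1r => def_p.
have sz_s : size s = n.
  by apply: succn_inj; rewrite -(size_prod_XsubC s id) -def_p size_XnsubC.
have uniq_s : uniq s.
  by rewrite -separable_prod_XsubC -def_p separable_Xn_sub_1 // pnatr_eq0 -lt0n.
exists (fun k : 'I_n => s`_k) => [i j /eqP|k].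
  by rewrite nth_uniq ?sz_s // => /eqP/val_inj.
have : root p s`_k by rewrite def_p root_prod_XsubC mem_nth ?sz_s.
by rewrite rootE !hornerE subr_eq0 => /eqP.
Qed.

(** A one-sided inverse of a square matrix is two-sided. *)
Lemma mulmx_scalarC (F : fieldType) n (A B : 'M[F]_n) (c : F) :
  c != 0 -> A *m B = c%:M -> B *m A = c%:M.
Proof.
move=> c0 AB; have : A *m (c^-1 *: B) = 1%:M.
  by rewrite -scalemxAr AB scale_scalar_mx mulVf.
move/mulmx1C/(congr1 ( *:%R c)); rewrite -scalemxAl scalerA divff // scale1r.
by rewrite scale_scalar_mx mulr1.
Qed.

Lemma leigenvalueP (F : fieldType) (vT : vectType F) (phi : 'End(vT)) (a : F) :
  reflect (exists2 v, v != 0 & phi v = a *: v) (passmx.leigenvalue phi a).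
Proof.
have inE v : (v \in passmx.leigenspace phi a) = (phi v == a *: v).
  by rewrite memv_ker add_lfunE opp_lfunE scale_lfunE id_lfunE subr_eq0.
rewrite /passmx.leigenvalue -vpick0; apply: (iffP idP) => [nz|[v nz /eqP]].
  exists (vpick (passmx.leigenspace phi a)) => //.
  by apply/eqP; rewrite -inE memv_pick.
rewrite -inE; apply: contraTneq => /eqP; rewrite vpick0 => /eqP->.
by rewrite memv0.
Qed.

(** * The Laplacian of K_{d,d} as a pair of matrix blocks *)

Section BipartiteLaplacian.
Variables (R : realType) (d : nat).
Local Notation K := (complete_bipartite d d).
Local Notation C := R[i].
Implicit Types (sigma : K -> K -> C) (f : {ffun K -> C^o}).

Definition lr_block sigma : 'M[C]_d := \matrix_(j, k) sigma (inl j) (inr k).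
Definition rl_block sigma : 'M[C]_d := \matrix_(k, j) sigma (inr k) (inl j).
Definition lpart f : 'cV[C]_d := \col_j f (inl j).
Definition rpart f : 'cV[C]_d := \col_k f (inr k).
Definition glue (v w : 'cV[C]_d) : {ffun K -> C^o} :=
  [ffun x : K => match x with inl j => v j 0 | inr k => w k 0 end].

Lemma glueK v w : lpart (glue v w) = v /\ rpart (glue v w) = w.
Proof. by split; apply/colP=> i; rewrite mxE ffunE. Qed.

Lemma parts_inj f g : lpart f = lpart g -> rpart f = rpart g -> f = g.
Proof.
move=> /colP eql /colP eqr; apply/ffunP => -[j|k].
  by have:= eql j; rewrite !mxE.
by have:= eqr k; rewrite !mxE.
Qed.

Lemma lpart_laplacian sigma f :
  lpart (magnetic_laplacian sigma f) =
    d%:R *: lpart f - lr_block sigma *m rpart f.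
Proof.
apply/colP=> j; rewrite !mxE ffunE big_sumType /= big_pred0_eq add0r.
rewrite sumrB sumr_const card_ord mulr_natl; congr (_ - _).
by apply: eq_bigr => k _; rewrite !mxE.
Qed.

Lemma rpart_laplacian sigma f :
  rpart (magnetic_laplacian sigma f) =
    d%:R *: rpart f - rl_block sigma *m lpart f.
Proof.
apply/colP=> j; rewrite !mxE ffunE big_sumType /= big_pred0_eq addr0.
rewrite sumrB sumr_const card_ord mulr_natl; congr (_ - _).
by apply: eq_bigr => k _; rewrite !mxE.
Qed.

Lemma laplacian_eigenP sigma (a : C) :
  reflect (exists f, [/\ f != 0,
             lr_block sigma *m rpart f = (d%:R - a) *: lpart f &
             rl_block sigma *m lpart f = (d%:R - a) *: rpart f])
    (passmx.leigenvalue (linfun (magnetic_laplacian sigma)) a).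
Proof.
have eqE (u v : 'cV[C]_d) : d%:R *: u - v = a *: u <-> v = (d%:R - a) *: u.
  rewrite scalerBl; split=> [<-|->]; first by rewrite subKr.
  by rewrite subKr.
have partZ f :
    (lpart (a *: f) = a *: lpart f) * (rpart (a *: f) = a *: rpart f).
  by split; apply/colP=> i; rewrite !mxE ffunE.
apply: (iffP (leigenvalueP _ _ _ _)) => [] [f].
  rewrite lfunE /= => nz eqf; exists f; split=> //; apply/eqE.
  - by rewrite -lpart_laplacian eqf partZ.
  - by rewrite -rpart_laplacian eqf partZ.
case=> nz /eqE eql /eqE eqr; exists f; rewrite // lfunE /=.
by apply: parts_inj; rewrite ?lpart_laplacian ?rpart_laplacian partZ.
Qed.

(** A singular vector of [lr_block] with nonzero singular value [s]
extends to an eigenfunction, by transporting it to the other side. *)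
Lemma laplacian_eigen_of_singular sigma (s : C) (v : 'cV[C]_d) :
    s != 0 -> v != 0 ->
    lr_block sigma *m rl_block sigma *m v = s ^+ 2 *: v ->
  passmx.leigenvalue (linfun (magnetic_laplacian sigma)) (d%:R - s).
Proof.
move=> s0 v0 eqv; apply/laplacian_eigenP; rewrite subKr.
have [eql eqr] := glueK v (s^-1 *: (rl_block sigma *m v)).
exists (glue v (s^-1 *: (rl_block sigma *m v))); rewrite eql eqr; split.
- apply: contra_neq v0 => f0; rewrite -eql f0.
  by apply/colP=> j; rewrite !mxE ffunE.
- by rewrite -scalemxAr mulmxA eqv scalerA expr2 mulKf.
- by rewrite scalerA mulfV // scale1r.
Qed.

(** Inverse and conjugate agree on the unit circle. *)
Lemma potential_blocks {sigma} : magnetic_potential sigma ->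
  rl_block sigma = (lr_block sigma)^t*.
Proof.
move=> pot; apply/matrixP=> k j; rewrite !mxE.
have [nrm ->] := pot (inl j) (inr k) isT.
by rewrite invC_norm nrm expr1n invr1 mul1r.
Qed.

(** Each of the [d^2] summands of the trace is [z * z^-1 = 1]. *)
Lemma potential_trace sigma : magnetic_potential sigma ->
  \tr (lr_block sigma *m rl_block sigma) = d%:R * d%:R.
Proof.
move=> pot; rewrite /mxtrace -[X in X%:R * _]card_ord mulr_natl -sumr_const.
apply: eq_bigr => j _; rewrite mxE -[X in X%:R]card_ord -sumr_const.
apply: eq_bigr => k _; rewrite !mxE.
have [nrm ->] := pot (inl j) (inr k) isT.
by rewrite divff // -normr_eq0 nrm oner_eq0.
Qed.

(** * The upper bound *)

Lemma lambda1_le sigma : (0 < d)%N -> magnetic_potential sigma ->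
  lambda1 sigma <= d%:R - Num.sqrt d%:R.
Proof.
move=> d_gt0 pot; have dR_gt0 : (0 : R) < d%:R by rewrite ltr0n.
rewrite /lambda1; case: xgetP => [l _ [_ l_min]|_]; last first.
  (* Without a smallest eigenvalue, [lambda1] is the default value 0. *)
  rewrite subr_ge0 -[leRHS](sqr_sqrtr (ltW dR_gt0)) expr2.
  rewrite ler_peMl ?sqrtr_ge0 //.
  by rewrite -[leLHS]sqrtr1 ler_wsqrtr // ler1n.
have herm : lr_block sigma *m rl_block sigma \is hermsymmx.
  apply/is_hermitianmxP; rewrite expr0 scale1r (potential_blocks pot).
  by rewrite trmx_mul map_mxM trmxCK.
have [mu [v v0 eqv]] := hermitian_eigen_ge_avg _ _ _ d_gt0 herm.
rewrite potential_trace // ler_pM2l ?ltr0n // -(rmorph_nat (real_complex R)).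
case: mu eqv => m im eqv; rewrite lecE /= => /andP[/eqP im0 le_dm].
have m_gt0 : 0 < m by apply: lt_le_trans le_dm.
have eq_m : (m +i* im) = (Num.sqrt m)%:C ^+ 2.
  by rewrite -rmorphXn /= sqr_sqrtr ?im0 // ltW.
have s_neq0 : (Num.sqrt m)%:C != 0 by rewrite fmorph_eq0 gt_eqF // sqrtr_gt0.
rewrite eq_m in eqv.
have := l_min _ (laplacian_eigen_of_singular _ _ _ s_neq0 v0 eqv).
rewrite -(rmorph_nat (real_complex R)) -rmorphB lecR => /le_trans; apply.
by rewrite lerB // ler_wsqrtr.
Qed.

(** * Potentials attaining the bound *)

(** The exchange operator squares to [d], so each eigenvalue [mu] satisfies
[(d - mu)^2 = d]; this leaves only [d - sqrt d] and [d + sqrt d], and the first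
one occurs because every vector is singular with singular value [sqrt d]. *)
Lemma lambda1_of_orthogonal sigma : (0 < d)%N ->
    lr_block sigma *m rl_block sigma = d%:R%:M ->
  lambda1 sigma = d%:R - Num.sqrt d%:R.
Proof.
move=> d_gt0 orth; set l := d%:R - _.
have dC0 : (d%:R : C) != 0 by rewrite pnatr_eq0 -lt0n.
have orth' := mulmx_scalarC _ _ _ _ _ dC0 orth.
have sq_d : (Num.sqrt d%:R)%:C ^+ 2 = d%:R :> C.
  by rewrite -rmorphXn /= sqr_sqrtr ?ler0n // rmorph_nat.
have lC : l%:C = d%:R - (Num.sqrt d%:R)%:C by rewrite rmorphB rmorph_nat.
have min_l : smallest_eigenvalue (linfun (magnetic_laplacian sigma)) l.
  split.
    rewrite lC; apply: (laplacian_eigen_of_singular _ _ (const_mx 1)).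
    - by rewrite fmorph_eq0 gt_eqF // sqrtr_gt0 ltr0n.
    - apply/eqP=> /colP/(_ (Ordinal d_gt0))/eqP.
      by rewrite !mxE oner_eq0.
    - by rewrite orth sq_d mul_scalar_mx.
  move=> mu /laplacian_eigenP[f [f0 eql eqr]].
  have sq_mu : (d%:R - mu) ^+ 2 = d%:R.
    apply: contra_neq_eq f0 => ne.
    have kill (u : 'cV[C]_d) : d%:R *: u = (d%:R - mu) ^+ 2 *: u -> u = 0.
      move/eqP; rewrite -subr_eq0 -scalerBl scaler_eq0 subr_eq0 eq_sym.
      by rewrite (negPf ne) => /eqP.
    have [l0 r0] : lpart f = 0 /\ rpart f = 0.
      split; apply: kill; rewrite -mul_scalar_mx expr2 -scalerA.
        by rewrite -eql scalemxAr -eqr mulmxA orth.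
      by rewrite -eqr scalemxAr -eql mulmxA orth'.
    by apply: parts_inj; rewrite ?l0 ?r0; apply/colP=> i; rewrite !mxE ffunE.
  move: sq_mu; rewrite -[RHS]sq_d => /eqP; rewrite eqf_sqr => /orP[]/eqP eq_mu.
    by rewrite lC -eq_mu subKr.
  have -> : mu = d%:R + (Num.sqrt d%:R)%:C.
    by rewrite -[mu](subKr d%:R) eq_mu opprK.
  by rewrite lC lerD2l -rmorphN lecR ge0_cp // sqrtr_ge0.
apply: xget_unique => // l' [eig' min'].
have [eig min] := min_l; have := min _ eig'; have := min' _ eig.
by rewrite !lecR => le_l'l le_ll'; apply/eqP; rewrite eq_le le_l'l le_ll'.
Qed.

End BipartiteLaplacian.

(** The potential is [r_k ^ j] on the edge from left vertex [j] to right vertex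
[k].  The columns for distinct roots are orthogonal because their inner product
is the geometric sum of [q = r_l / r_k], where [q != 1] and [q^d = 1];
[mulmx_scalarC] turns this into orthogonality of the rows. *)
Lemma fourier_potential (R : realType) d : (0 < d)%N ->
  exists2 sigma, @magnetic_potential R (complete_bipartite d d) sigma
    & lr_block R d sigma *m rl_block R d sigma = d%:R%:M.
Proof.
move=> d_gt0; have [r r_inj r_unity] := distinct_unity_roots R[i] d d_gt0.
have r_norm k : `|r k| = 1.
  apply/eqP; rewrite -(@pexpr_eq1 _ _ d) ?normr_ge0 //.
  by rewrite -normrX r_unity normr1.
have r_neq0 k : r k != 0 by rewrite -normr_eq0 r_norm oner_eq0.
pose sigma (x y : complete_bipartite d d) : R[i] :=
  match x, y with
  | inl j, inr k => r k ^+ j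
  | inr k, inl j => r k ^- j
  | _, _ => 1
  end.
exists sigma.
  move=> [j|k] [j'|k'] //= _; rewrite ?normfV normrX r_norm expr1n ?invr1 //.
  by rewrite invrK.
apply: mulmx_scalarC; first by rewrite pnatr_eq0 -lt0n.
apply/matrixP=> k l; rewrite !mxE.
pose q := r l / r k.
under eq_bigr => j _ do rewrite !mxE /= mulrC -exprVn -exprMn -/q.
have [eq_kl|kl] := eqVneq k l.
  rewrite /q eq_kl divff //; under eq_bigr => j _ do rewrite expr1n.
  by rewrite sumr_const card_ord.
have q_neq1 : q - 1 != 0.
  apply: contra_neq kl => /eqP; rewrite subr_eq0 => /eqP q1.
  by apply: r_inj; rewrite -[RHS](divfK (r_neq0 k)) -/q q1 mul1r.
apply: (mulfI q_neq1); rewrite -subrX1 mulr0n mulr0 exprMn exprVn !r_unity.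
by rewrite divr1 subrr.
Qed.

(** * The height of K_{d,d} *)

Theorem corollary3p16 (R : realType) (d : nat) (hd : (2 <= d)%N) :
  magneto_spectral_height R (complete_bipartite d d)
    = d%:R - Num.sqrt (d%:R : R).
Proof.
have d_gt0 : (0 < d)%N := ltnW hd.
have [sigma pot orth] := fourier_potential R d d_gt0.
have eq_l := lambda1_of_orthogonal R d sigma d_gt0 orth.
set S := [set lambda1 s | s in @magnetic_potential R (complete_bipartite d d)
         ]%classic.
have ubS : ubound S (d%:R - Num.sqrt (d%:R : R)).
  by move=> _ [s pot_s <-]; apply: lambda1_le.
have inS : S (d%:R - Num.sqrt (d%:R : R)) by exists sigma.
apply: le_anti; apply/andP; split.
  by apply: ge_sup => //; exists (d%:R - Num.sqrt (d%:R : R)).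
by apply: ub_le_sup => //; exists (d%:R - Num.sqrt (d%:R : R)).
Qed.
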